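(* Let $n$ be a positive integer and let $A=[a_{i,j}]_{1\le i,j\le n}$ be a matrix over a commutative ring. Suppose that $a_{i,j}=0$ whenever $i+j$ is an even number greater than two. (i) If $n=2m$ for some positive integer $m$, then $$\mathrm{per}(A)=\mathrm{per}[a_{2i,2j-1}]_{1\le i,j\le m}\cdot\mathrm{per}[a_{2i-1,2j}]_{1\le i,j\le m}$$ and $$\det(A)=(-1)^m\det[a_{2i,2j-1}]_{1\le i,j\le m}\cdot\det[a_{2i-1,2j}]_{1\le i,j\le m}.$$ (ii) If $n=2m+1$ for some positive integer $m$, then $$\mathrm{per}(A)=a_{1,1}\cdot\mathrm{per}[a_{2i,2j+1}]_{1\le i,j\le m}\cdot\mathrm{per}[a_{2i+1,2j}]_{1\le i,j\le m}$$ and $$\det(A)=(-1)^m a_{1,1}\det[a_{2i,2j+1}]_{1\le i,j\le m}\cdot\det[a_{2i+1,2j}]_{1\le i,j\le m}.$$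
   Context: For an $n\times n$ matrix $A=[a_{i,j}]_{1\le i,j\le n}$ over a commutative ring, $\det(A)=\sum_{\sigma\in S_n}\mathrm{sign}(\sigma)\prod_{i=1}^n a_{i,\sigma(i)}$ is the determinant and $\mathrm{per}(A)=\sum_{\sigma\in S_n}\prod_{i=1}^n a_{i,\sigma(i)}$ is the permanent, where $S_n$ is the symmetric group on $\{1,\ldots,n\}$. *)

(* Defs.v *)
From mathcomp Require Import all_boot all_order all_fingroup all_algebra.

Set Implicit Arguments.
Unset Strict Implicit.
Unset Printing Implicit Defensive.

Import GRing.Theory.
Local Open Scope ring_scope.

(* Counterpart of the Leibniz formula [determinant] of matrix.v. *)
Definition permanent (R : comPzRingType) (n : nat) (A : 'M[R]_n) : R :=
  \sum_(s : 'S_n) \prod_(i < n) A i (s i).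

(* The matrix [f(i,j)]_{1 <= i, j <= n}: the indices passed to [f] start at 1,
   whereas the ordinals indexing the rows and columns start at 0. *)
Definition mx1 (R : Type) (n : nat) (f : nat -> nat -> R) : 'M[R]_n :=
  \matrix_(i < n, j < n) f i.+1 j.+1.

(* Main.v *)
Require Import Defs.
From mathcomp Require Import all_boot all_order all_fingroup all_algebra.
From mathcomp Require Import zify.

Set Implicit Arguments.
Unset Strict Implicit.
Unset Printing Implicit Defensive.

Import GRing.Theory.
Local Open Scope ring_scope.

(* For [eps ^ 2 = 1], the sum of [eps ^ sgn(s) * prod_i A i (s i)] over the
   permutations [s] is the permanent for [eps = 1] and the determinant for
   [eps = -1]; it obeys Laplace expansion and changes by [eps ^ sgn(s)] when the
   rows or the columns are permuted by [s], so both identities are proved at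
   once.
   Swapping the columns 2i-1 and 2i (n = 2m), or 2i and 2i+1 (n = 2m+1), costs
   [eps ^ m] and moves the nonzero entries, apart from those of the first row
   and column, to positions (i, j) with i + j even. Permuting the rows and the
   columns simultaneously, so that the rows of equal parity become contiguous,
   gives a block lower triangular matrix, whose diagonal blocks are the two
   matrices of the theorem (and the 1 x 1 block [a 1 1] if n is odd). *)

Definition epsdet (R : comPzRingType) (eps : R) (n : nat) (A : 'M[R]_n) : R :=
  \sum_(s : 'S_n) eps ^+ s * \prod_(i < n) A i (s i).

Lemma epsdet1 (R : comPzRingType) (n : nat) (A : 'M[R]_n) :
  epsdet 1 A = permanent A.
Proof. by apply: eq_bigr => s _; rewrite expr1n mul1r. Qed.

Lemma epsdetN1 (R : comPzRingType) (n : nat) (A : 'M[R]_n) :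
  epsdet (-1) A = \det A.
Proof. by []. Qed.

Lemma expr_odd_idem (R : comPzRingType) (eps : R) (k : nat) :
  eps * eps = 1 -> eps ^+ odd k = eps ^+ k.
Proof.
move=> eps2; rewrite -[in RHS](odd_double_half k) exprD -mul2n exprM expr2.
by rewrite eps2 expr1n mulr1.
Qed.

Lemma expr_addb (R : comPzRingType) (eps : R) (b c : bool) :
  eps * eps = 1 -> eps ^+ (b (+) c) = eps ^+ b * eps ^+ c.
Proof.
by case: b c => [] [] eps2; rewrite ?expr0 ?expr1 ?mulr1 ?mul1r ?eps2.
Qed.

(** Substituting [s * v * t^-1] for the summation permutation turns the entry in row [i] into
    [A (s i) (v (s i))]; the product over [i] is then reindexed by [s]. *)
Lemma epsdet_reindex (R : comPzRingType) (eps : R) (n : nat) (A : 'M[R]_n)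
    (s t : 'S_n) :
  eps * eps = 1 ->
  epsdet eps (\matrix_(i, j) A (s i) (t j)) = eps ^+ (s (+) t) * epsdet eps A.
Proof.
move=> eps2; rewrite /epsdet mulr_sumr.
rewrite (reindex (fun v : 'S_n => s * v * t^-1)%g); last first.
  exists (fun u : 'S_n => s^-1 * u * t)%g => u _.
    by rewrite !mulgA mulVg mul1g mulgKV.
  by rewrite !mulgA mulgV mul1g mulgK.
apply: eq_bigr => v _; rewrite mulrA -expr_addb // !odd_permM odd_permV.
congr (eps ^+ _ * _); first by rewrite addbAC.
rewrite [RHS](reindex_inj (@perm_inj _ s)).
by apply: eq_bigr => i _; rewrite mxE !permM permKV.
Qed.

Lemma epsdet_mx0 (R : comPzRingType) (eps : R) (A : 'M[R]_0) : epsdet eps A = 1.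
Proof.
rewrite /epsdet (big_pred1 (1%g : 'S_0)) ?odd_perm1 ?mul1r ?big_ord0 // => s.
by apply/esym/eqP/permP => -[].
Qed.

(** Sorts the permutations by their value at [i], as Laplace expansion requires. Injectivity
    suffices, since (n+1) n! = (n+1)!. *)
Lemma lift_perm_bij (n : nat) (i : 'I_n.+1) :
  bijective (fun p : 'I_n.+1 * 'S_n => lift_perm i p.1 p.2).
Proof.
apply: inj_card_bij => [[j s] [k t] /= /permP eq_st|].
  have eq_jk: j = k by have := eq_st i; rewrite !lift_perm_id.
  rewrite -{}eq_jk in eq_st *; congr (_, _); apply/permP => l.
  by have := eq_st (lift i l); rewrite !lift_perm_lift; apply: lift_inj.
by rewrite card_prod card_ord !card_Sn.
Qed.

Lemma epsdet_expand_row (R : comPzRingType) (eps : R) (n : nat)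
    (A : 'M[R]_n) (i0 : 'I_n) :
  eps * eps = 1 ->
  epsdet eps A =
    \sum_j A i0 j * (eps ^+ (i0 + j) * epsdet eps (row' i0 (col' j A))).
Proof.
case: n A i0 => [|n] A i0 eps2; first by case: i0.
rewrite /epsdet.
rewrite (reindex (fun p : 'I_n.+1 * 'S_n => lift_perm i0 p.1 p.2)) /=;
  last exact/onW_bij/lift_perm_bij.
rewrite -(pair_big predT predT (fun j s => eps ^+ lift_perm i0 j s *
  \prod_(i < n.+1) A i (lift_perm i0 j s i))) /=.
apply: eq_bigr => j _; rewrite !mulr_sumr; apply: eq_bigr => s _.
rewrite odd_lift_perm !expr_addb // !expr_odd_idem // -exprD.
rewrite (bigD1_ord i0) //= lift_perm_id mulrCA !mulrA; congr (_ * _).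
by apply: eq_bigr => i _; rewrite !mxE lift_perm_lift.
Qed.

Lemma epsdet_mx11 (R : comPzRingType) (eps : R) (A : 'M[R]_1) :
  eps * eps = 1 -> epsdet eps A = A 0 0.
Proof.
move=> eps2; rewrite (epsdet_expand_row _ 0) // big_ord_recl big_ord0.
by rewrite epsdet_mx0 !mulr1 addr0.
Qed.

(** Expansion along the first row, which vanishes to the right of [Aul]; the remaining minors have
    the same block shape. *)
Lemma epsdet_lblock (R : comPzRingType) (eps : R) (n1 n2 : nat)
    (Aul : 'M[R]_n1) (Adl : 'M[R]_(n2, n1)) (Adr : 'M[R]_n2) :
  eps * eps = 1 ->
  epsdet eps (block_mx Aul 0 Adl Adr) = epsdet eps Aul * epsdet eps Adr.
Proof.
move=> eps2; elim: n1 => [|n1 IHn1] in Aul Adl *.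
  rewrite epsdet_mx0 mul1r; congr (epsdet eps _); apply/matrixP=> i j.
  by do 2![rewrite !mxE; case: splitP => [[]|k] //=; move/val_inj=> <- {k}].
rewrite (epsdet_expand_row _ (lshift n2 0)) // big_split_ord /=.
rewrite [X in _ + X]big1 => [|i _]; last by rewrite block_mxEur mxE mul0r.
rewrite addr0 (epsdet_expand_row _ 0) // big_distrl /=; apply: eq_bigr => j _.
rewrite block_mxEul -!mulrA; do 2!congr (_ * _).
by rewrite col'_col_mx !col'Kl row'Ku row'_row_mx raddf0 IHn1.
Qed.

(** Lets permutations be given by arithmetic formulas, whose conditions [lia] decides. *)
Lemma perm_of_nat_fun (n : nat) (f : nat -> nat) :
  (forall i, i < n -> f i < n)%N ->
  (forall i j, i < n -> j < n -> f i = f j -> i = j)%N ->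
  exists s : 'S_n, forall i, s i = f i :> nat.
Proof.
move=> f_lt f_inj.
have fP (i : 'I_n) : insubd i (f i) = f i :> nat.
  by rewrite val_insubd f_lt.
have g_inj : injective (fun i : 'I_n => insubd i (f i)).
  move=> i j /(congr1 val) /=; rewrite !fP => /f_inj ij.
  by apply: val_inj; apply: ij.
by exists (perm g_inj) => i; rewrite permE fP.
Qed.

(** The product of the m disjoint transpositions of e + 2k and e + 2k + 1, k < m. The offset [e] is
    0 for even size and 1 for odd size, where the first index stays fixed. *)
Lemma swap_adjacent_perm (n e m : nat) : (e + 2 * m <= n)%N ->
  exists2 s : 'S_n, odd_perm s = odd m & forall i : 'I_n, s i =
    (if (i < e) || (e + 2 * m <= i) then i : nat
     else if odd (i - e) then i.-1 else i.+1)%N :> nat.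
Proof.
elim: m => [|m IHm] le_n.
  by exists 1%g => [|i]; rewrite ?odd_perm1 // perm1; case: ifP => //; lia.
have [|s sgn_s sE] := IHm; first lia.
have lt1 : (e + 2 * m < n)%N by lia.
have lt2 : ((e + 2 * m).+1 < n)%N by lia.
pose i1 := Ordinal lt1; pose i2 := Ordinal lt2.
exists (s * tperm i1 i2)%g => [|i].
  by rewrite odd_permM sgn_s odd_tperm -val_eqE /= neq_ltn ltnSn addbT.
rewrite permM; have := sE i.
by case: tpermP => [->|->|/eqP + /eqP]; rewrite -?val_eqE /=;
  do !case: ifP; lia.
Qed.

Lemma epsdet_even (R : comPzRingType) (eps : R) (m : nat)
    (a : nat -> nat -> R) :
  eps * eps = 1 ->
  (forall i j : nat, (1 <= i <= m + m)%N -> (1 <= j <= m + m)%N ->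
     ~~ odd (i + j) -> (2 < i + j)%N -> a i j = 0) ->
  epsdet eps (mx1 (m + m) a) =
    eps ^+ m * epsdet eps (mx1 m (fun i j => a (2 * i)%N (2 * j - 1)%N))
             * epsdet eps (mx1 m (fun i j => a (2 * i - 1)%N (2 * j)%N)).
Proof.
move=> eps2 a_eq0.
(* Ordinals start at 0: parities are opposite to those of the indices of [a]. *)
pose f i := (if i < m then 2 * i + 1 else 2 * (i - m))%N.
have [||s sE] := @perm_of_nat_fun (m + m) f.
- by move=> i; rewrite /f; case: ifP; lia.
- by move=> i j; rewrite /f; do !case: ifP; lia.
have [|t sgn_t tE] := @swap_adjacent_perm (m + m) 0 m; first lia.
have stE i : (s * t)%g i = (if i < m then 2 * i else 2 * (i - m) + 1)%N :> nat.
  rewrite permM tE sE /f; have := ltn_ord i.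
  by do !case: ifP; lia.
(* Writing 1 as [eps ^+ m * eps ^+ m] moves the sign to the left, where it becomes the cost of
   permuting rows by [s] and columns by [s * t]. *)
rewrite -!mulrA -[LHS]mul1r -(expr1n _ m) -eps2 exprMn -mulrA; congr (_ * _).
rewrite -expr_odd_idem // -sgn_t (_ : odd_perm t = s (+) (s * t)%g); last first.
  by rewrite odd_permM addKb.
(* The lower left block has odd row and column indices, so it may contain the nonzero entry [a 1 1];
   the upper right one has even indices and vanishes. *)
rewrite -epsdet_reindex // -(epsdet_lblock _ (\matrix_(i < m, j < m)
  a (2 * i + 1)%N (2 * j + 1)%N)) //.
congr (epsdet eps _); apply/matrixP => i j.
rewrite !mxE sE stE /f.
case: splitP => [i' ->|i' ->]; rewrite mxE; case: splitP => [j' ->|j' ->];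
  rewrite !mxE ?ltn_ord ?ltnNge ?leq_addr /=.
- by congr (a _ _); lia.
- by apply: a_eq0; have := ltn_ord i'; have := ltn_ord j'; lia.
- by congr (a _ _); lia.
- by congr (a _ _); lia.
Qed.

Lemma epsdet_odd (R : comPzRingType) (eps : R) (m : nat)
    (a : nat -> nat -> R) :
  eps * eps = 1 ->
  (forall i j : nat, (1 <= i <= m + 1 + m)%N -> (1 <= j <= m + 1 + m)%N ->
     ~~ odd (i + j) -> (2 < i + j)%N -> a i j = 0) ->
  epsdet eps (mx1 (m + 1 + m) a) =
    eps ^+ m * a 1%N 1%N
    * epsdet eps (mx1 m (fun i j => a (2 * i)%N (2 * j + 1)%N))
    * epsdet eps (mx1 m (fun i j => a (2 * i + 1)%N (2 * j)%N)).
Proof.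
move=> eps2 a_eq0.
(* Ordinals start at 0: parities are opposite to those of the indices of [a]. *)
pose f i := (if i < m then 2 * i + 2 else
             if i == m then 0 else 2 * (i - m.+1) + 1)%N.
have [||s sE] := @perm_of_nat_fun (m + 1 + m) f.
- by move=> i; rewrite /f; do !case: ifP; lia.
- by move=> i j; rewrite /f; do !case: ifP; lia.
have [|t sgn_t tE] := @swap_adjacent_perm (m + 1 + m) 1 m; first lia.
have stE i : (s * t)%g i = (if i < m then 2 * i + 1 else
             if i == m :> nat then 0 else 2 * (i - m.+1) + 2)%N :> nat.
  rewrite permM tE sE /f; have := ltn_ord i.
  by do !case: ifP; lia.
rewrite -!mulrA -[LHS]mul1r -(expr1n _ m) -eps2 exprMn -mulrA; congr (_ * _).
rewrite -expr_odd_idem // -sgn_t (_ : odd_perm t = s (+) (s * t)%g); last first.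
  by rewrite odd_permM addKb.
rewrite -epsdet_reindex //.
(* Rows are now ordered as odd indices from 3 on, 1, even indices; columns as even indices, 1, odd
   indices from 3 on. [B] lies left of [a 1 1], and [C] fills the even rows below both, its last
   column having index 1. *)
pose B := \row_(j < m) a 1%N (2 * j + 2)%N.
pose C := \matrix_(i < m, j < m + 1)
  a (2 * i + 2)%N (if (j < m)%N then 2 * j + 2 else 1)%N.
have -> : a 1%N 1%N = epsdet eps ((a 1%N 1%N)%:M : 'M_1).
  by rewrite epsdet_mx11 // mxE.
rewrite mulrA mulrC mulrA -(epsdet_lblock _ B) // -(epsdet_lblock _ C) //.
congr (epsdet eps _); apply/matrixP => i j; rewrite !mxE sE stE /f.
case: splitP => [i' ->|i' ->]; rewrite mxE;
  case: (splitP j) => [j' ->|j' ->]; rewrite !mxE.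
- case: (splitP i') => [i'' ->|[[|//] ? ->]]; rewrite mxE;
    case: (splitP j') => [j'' ->|[[|//] ? ->]];
    rewrite !mxE ?ltn_ord /= ?addn0 ?ltnn ?eqxx //=.
  + by congr (a _ _); lia.
  + by apply: a_eq0; have := ltn_ord i''; lia.
  + by congr (a _ _); lia.
- by apply: a_eq0; have := ltn_ord i'; have := ltn_ord j'; do !case: ifP; lia.
- by congr (a _ _); have := ltn_ord j'; do !case: ifP; lia.
- by congr (a _ _); do !case: ifP; lia.
Qed.

Theorem theorem1p1 (R : comPzRingType) (n : nat) (n_gt0 : (0 < n)%N)
    (a : nat -> nat -> R) (A : 'M[R]_n) (defA : A = mx1 n a)
    (a_eq0 : forall i j : nat, (1 <= i <= n)%N -> (1 <= j <= n)%N ->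
       ~~ odd (i + j) -> (2 < i + j)%N -> a i j = 0) :
  (forall m : nat, (0 < m)%N -> n = (2 * m)%N ->
     permanent A = permanent (mx1 m (fun i j => a (2 * i)%N (2 * j - 1)%N))
                   * permanent (mx1 m (fun i j => a (2 * i - 1)%N (2 * j)%N))
     /\
     \det A = (-1) ^+ m * \det (mx1 m (fun i j => a (2 * i)%N (2 * j - 1)%N))
              * \det (mx1 m (fun i j => a (2 * i - 1)%N (2 * j)%N)))
  /\
  (forall m : nat, (0 < m)%N -> n = (2 * m + 1)%N ->
     permanent A = a 1%N 1%N
                   * permanent (mx1 m (fun i j => a (2 * i)%N (2 * j + 1)%N))
                   * permanent (mx1 m (fun i j => a (2 * i + 1)%N (2 * j)%N))
     /\
     \det A = (-1) ^+ m * a 1%N 1%N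
              * \det (mx1 m (fun i j => a (2 * i)%N (2 * j + 1)%N))
              * \det (mx1 m (fun i j => a (2 * i + 1)%N (2 * j)%N))).
Proof.
rewrite {}defA; split=> m _ n_eq.
  have {}n_eq: n = (m + m)%N by rewrite n_eq mul2n addnn.
  subst n; split.
    by rewrite -!epsdet1 epsdet_even ?mulr1 // expr1n mul1r.
  by rewrite -!epsdetN1 epsdet_even // mulrNN mulr1.
have {}n_eq: n = (m + 1 + m)%N by lia.
subst n; split.
  by rewrite -!epsdet1 epsdet_odd ?mulr1 // expr1n mul1r.
by rewrite -!epsdetN1 epsdet_odd // mulrNN mulr1.
Qed.
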